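(* Consider the autonomous differential equation $u_t=L(u)$, where $L$ is a smooth ($C^\infty$) function and $u=u(t)$ is a smooth solution defined in a neighbourhood of $t_n$. Let $p\ge 1$, let $C$ be a constant independent of $\tau$, put $\hat\tau=C\tau^p$, and let $\alpha=\alpha(\hat\tau)$ be a differentiable function of $\hat\tau$ with $\alpha(0)=\frac13$ and $\alpha\neq 1$. Set $u^n=u(t_n)$ and define the two-stage time discretization with time step $\tau>0$ by $$u^*=u^n+\frac{\tau}{3(1-\alpha)}L(u^n)+\frac{\tau^2}{12(1-\alpha)}\,\partial_tL(u^n),$$ $$u^{n+1}=u^n+\tau L(u^n)+\frac{\alpha\tau^2}{2}\,\partial_tL(u^n)+\frac{(1-\alpha)\tau^2}{2}\,\partial_tL(u^* ).$$ Then this discretization is fourth-order accurate, i.e. its one-step error satisfies $$u(t_n+\tau)-u^{n+1}=\mathcal O(\tau^5)\qquad\text{as }\tau\to0 .$$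
   Context: The unknown $u$ takes values in $\mathbb R^m$ (for example, $u_t=L(u)$ is a semi-discrete scheme for a system of conservation laws) and $L:\mathbb R^m\to\mathbb R^m$. For a state $w$, $\partial_tL(w)$ denotes the time derivative of $L$ along the differential equation evaluated at $w$, namely $\partial_tL(w)=L_u(w)L(w)$, where $L_u$ is the derivative (Jacobian) of $L$. *)

(* Defs.v *)
From mathcomp Require Import all_boot all_order all_algebra.
From mathcomp Require Import all_classical all_reals all_analysis.

Set Implicit Arguments.
Unset Strict Implicit.
Unset Printing Implicit Defensive.

Import Order.TTheory GRing.Theory Num.Theory.
Import numFieldNormedType.Exports.

Local Open Scope classical_set_scope.
Local Open Scope ring_scope.

(* C^k on an open set A.  The derivative of order k.+1 is handled one direction
   at a time; for finite-dimensional V (here V is R or R^m) asking that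
   x |-> 'd f x v be C^k for every v is the same as asking that x |-> 'd f x
   be C^k for the operator norm. *)
Fixpoint Ck_on (R : realType) (V W : normedModType R) (k : nat) (A : set V)
    (f : V -> W) : Prop :=
  if k is k'.+1 then
    (forall x, A x -> differentiable f x) /\
    (forall v : V, Ck_on k' A (fun x => 'd f x v))
  else forall x, A x -> {for x, continuous f}.

Definition smooth_on (R : realType) (V W : normedModType R) (A : set V)
    (f : V -> W) : Prop :=
  forall k : nat, Ck_on k A f.

Section scheme.
Variables (R : realType) (m : nat) (L : 'rV[R]_m -> 'rV[R]_m).

(* L_u(w) L(w): the differential of L at w applied to the vector L w. *)
Definition dtL (w : 'rV[R]_m) : 'rV[R]_m := 'd L w (L w).

(* In the next two definitions, a stands for the value of alpha at C tau^p. *)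
Definition ustar (a tau : R) (un : 'rV[R]_m) : 'rV[R]_m :=
  un + (tau / (3 * (1 - a))) *: L un + (tau ^+ 2 / (12 * (1 - a))) *: dtL un.

Definition unext (a tau : R) (un : 'rV[R]_m) : 'rV[R]_m :=
  un + tau *: L un + (a * tau ^+ 2 / 2) *: dtL un
     + ((1 - a) * tau ^+ 2 / 2) *: dtL (ustar a tau un).

End scheme.

(* Main.v *)
Require Import Defs.
From mathcomp Require Import all_boot all_order all_algebra.
From mathcomp Require Import all_classical all_reals all_analysis.
From mathcomp Require Import ring lra.
Import Order.TTheory GRing.Theory Num.Theory.
Import numFieldNormedType.Exports.
Local Open Scope classical_set_scope.
Local Open Scope ring_scope.

Set Implicit Arguments.
Unset Strict Implicit.
Unset Printing Implicit Defensive.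

(** Write G for dtL L, so that u' = L(u) and u'' = G(u) along the solution.  The
    stage ustar is an approximation of the exact solution at the intermediate
    time tn + s, where s = tau / (3 (1 - a)) and a is the current value of
    alpha.  Comparing with u(tn + s) reduces the analysis of the scheme to
    one-dimensional Taylor expansions along u, with no second derivative of G.

    The stage reproduces the Taylor polynomial of u(tn + s) up to degree 1
    exactly, and its degree 2 term up to a multiple of tau^2 (1 - 3 a).  As
    alpha(0) = 1/3 and C tau^p = O(tau), the factor 1 - 3 a is O(tau)
    (powR_perturbation_le), hence ustar = u(tn + s) + O(tau^3)
    (ustar_defectE).  Since G is locally Lipschitz (dtL_lipschitz_near),
    G(ustar) = u''(tn + s) + O(tau^3), and u''(tn + s) has a Taylor expansion
    in terms of the derivatives of u of orders 2, 3 and 4 at tn.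

    In unext this value is multiplied by (1 - a) tau^2 / 2.  Comparing with the
    fourth-order expansion of u(tn + tau) (unext_defectE), the coefficients of
    the second and third derivatives agree for every a, because
    (1 - a) s / 2 = tau / 6, and those of the fourth derivative differ by a
    multiple of tau^4 (1 - 3 a), which is O(tau^5).  The Taylor remainders are
    bounded in taylor_remainder_le, which rests on a mean value inequality for
    row vectors. *)

(** * Mean value inequality and Taylor remainder for row vectors *)

Lemma coord_norm_le (R : realType) (m : nat) (M : 'rV[R]_m) (j : 'I_m) :
  `|M 0 j| <= `|M|.
Proof.
rewrite [leRHS]/Num.Def.normr/= mx_normrE.
exact: (le_bigmax _ (fun ij => `|M ij.1 ij.2|) (0, j)).
Qed.

Lemma row_norm_le (R : realType) (m : nat) (M : 'rV[R]_m) (K : R) :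
  0 <= K -> (forall j, `|M 0 j| <= K) -> `|M| <= K.
Proof.
move=> K0 MK; rewrite [leLHS]/Num.Def.normr/= mx_normrE.
by apply: bigmax_le => // -[i j] _ /=; rewrite (ord1 i).
Qed.

(** The norm on rows is the maximum of the coordinates, so it suffices to apply
    the scalar mean value theorem to each coordinate, each with its own
    intermediate point. *)
Lemma mean_value_norm_le (R : realType) (m : nat) (f df : R -> 'rV[R]_m)
    (a b K : R) : a <= b ->
    (forall t, a <= t <= b -> is_derive t 1 f (df t)) ->
    (forall t, a <= t <= b -> `|df t| <= K) ->
  `|f b - f a| <= K * (b - a).
Proof.
move=> ab fdf dfK.
have K0 : 0 <= K by apply: le_trans (dfK a _); rewrite ?lexx.
apply: row_norm_le => [|j]; first by rewrite mulr_ge0 // subr_ge0.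
have dfj t : a <= t <= b -> is_derive t 1 (fun x => f x 0 j : R) (df t 0 j).
  move=> /fdf [ft dft]; apply: DeriveDef.
    by have /derivable_mxP := ft; exact.
  by rewrite -dft derive_mx // mxE.
have [t|t|c] := @MVT_segment R (fun x => f x 0 j) (fun x => df x 0 j) a b ab.
- by rewrite in_itv/= => /andP[/ltW at_ /ltW tb]; apply: dfj; rewrite at_ tb.
- apply: derivable_within_continuous => t'; rewrite in_itv/= => /dfj.
  by case.
rewrite in_itv/= => acb fE; rewrite !mxE fE normrM.
rewrite (ger0_norm (x := b - a)) ?subr_ge0 //.
rewrite ler_wpM2r ?subr_ge0 //; apply: le_trans (dfK c acb).
exact: coord_norm_le.
Qed.

Lemma is_derive_scalev (R : realType) (V : normedModType R) (a : R -> R)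
    (t da : R) (v : V) :
  is_derive t 1 a da -> is_derive t 1 (fun x => a x *: v) (da *: v).
Proof.
move=> [/derivable1_diffP adiff <-].
have vdiff : is_diff (a t) ( *:%R^~ v : R -> V) ( *:%R^~ v).
  exact: is_diff_scalel.
have [avdiff avE] := is_diff_comp (differentiableP adiff) vdiff.
apply: DeriveDef; first exact/derivable1_diffP.
by rewrite deriveE // avE /= deriveE.
Qed.

(** Induction on n: the derivative of the remainder of order n.+1 of f 0 is the
    remainder of order n of f 1, and the former vanishes at t0, so the mean
    value inequality gains one power of t - t0.  The functions f k are separate
    data, linked only near t0, because a solution of the differential equation
    is smooth only where it is defined. *)
Lemma taylor_remainder_le (R : realType) (m n : nat) (f : nat -> R -> 'rV[R]_m)
    (t0 : R) :
    (\forall t \near t0, forall k, (k < n)%N ->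
       is_derive (t : R) 1 (f k) (f k.+1 t)) ->
    {for t0, continuous (f n)} ->
  exists2 M : R, 0 <= M & \forall t \near t0, t0 <= t ->
    `|f 0%N t - \sum_(k < n) ((t - t0) ^+ k / k`!%:R) *: f k t0|
      <= M * (t - t0) ^+ n.
Proof.
elim: n f => [|n IHn] f df cf.
  exists (`|f 0%N t0| + 1); first by rewrite addr_ge0.
  have : \forall t \near t0, `|f 0%N t| <= `|f 0%N t0| + 1.
    have cf0 : f 0%N t @[t --> t0] --> f 0%N t0 := cf.
    by apply: (cvgr_norm_le _ cf0); rewrite ltrDl.
  apply: filterS => t ft _.
  by rewrite big_ord0 subr0 expr0 mulr1.
have [|//|M M0 HM] := IHn (fun k => f k.+1).
  by apply: filterS df => t dft k kn; apply: dft.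
exists M => //.
have [e /= e0 He] := (nbhs_ballP _ _).1 (filterI df HM).
apply/nbhs_ballP; exists e => //= t te t0t.
set g := fun x => f 0%N x - \sum_(k < n.+1) ((x - t0) ^+ k / k`!%:R) *: f k t0.
set dg := fun x => f 1%N x - \sum_(k < n) ((x - t0) ^+ k / k`!%:R) *: f k.+1 t0.
have g0 : g t0 = 0.
  rewrite /g big_ord_recl /= expr0 fact0 divr1 scale1r big1 ?addr0 ?subrr //.
  by move=> i _; rewrite exprS !mul0r scale0r.
have in_ball x : t0 <= x <= t -> ball t0 e x.
  move=> /andP[t0x xt]; move: te; rewrite /ball/= !(distrC t0).
  by rewrite !ger0_norm ?subr_ge0 //; apply: le_lt_trans; rewrite lerD2r.
rewrite -/(g t) -(subr0 (g t)) -g0 exprSr mulrA.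
apply: (@mean_value_norm_le R m g dg t0 t) => // x xt.
  have [dfx _] := He _ (in_ball _ xt).
  have df0 := dfx 0%N isT.
  rewrite /g /dg.
  have -> : (fun x => f 0%N x -
      \sum_(k < n.+1) ((x - t0) ^+ k / k`!%:R) *: f k t0)
    = f 0%N - \sum_(k < n.+1) (fun x => ((x - t0) ^+ k / k`!%:R) *: f k t0).
    by apply/funext => y; rewrite !fctE fct_sumE.
  apply: is_deriveB.
  have -> : \sum_(k < n) ((x - t0) ^+ k / k`!%:R) *: f k.+1 t0 =
     \sum_(k < n.+1) ((k%:R * (x - t0) ^+ k.-1) / k`!%:R) *: f k t0.
    rewrite big_ord_recl /= !mul0r scale0r add0r.
    apply: eq_bigr => i _; congr (_ *: _).
    rewrite /bump leq0n add1n factS natrM invfM /= mulrACA divff ?mul1r //.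
  apply: is_derive_sum => k; apply: is_derive_scalev.
  rewrite [X in is_derive _ _ X](_ : _ =
    (k`!%:R^-1 : R) \*: (shift (- t0) ^+ k : R -> R)); last first.
    by apply: funext => y; rewrite mulrC !fctE.
  apply: is_derive_eq.
  by rewrite /GRing.scale /= subr0 mulr1 mulrC.
have [_ HMx] := He _ (in_ball _ xt).
have /andP[t0x xt'] := xt.
apply: le_trans (HMx t0x) _.
by rewrite ler_wpM2l // lerXn2r ?nnegrE ?subr_ge0 // lerD2r.
Qed.

(** * Local Lipschitz bounds *)

Lemma linear_norm_le (R : realType) (m : nat) (W : normedModType R)
    (g : {linear 'rV[R]_m -> W}) (v : 'rV[R]_m) :
  `|g v| <= (\sum_i `|g (delta_mx 0 i)|) * `|v|.
Proof.
rewrite [in leLHS](row_sum_delta v) linear_sum mulr_suml.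
apply: le_trans (ler_norm_sum _ _ _) _; apply: ler_sum => i _.
by rewrite linearZ normrZ mulrC ler_wpM2l // coord_norm_le.
Qed.

(** Near x0 the partial derivatives are bounded by continuity; the mean value
    inequality along a segment inside a ball around x0 turns this into a
    Lipschitz bound.  Both points have to vary: differentiability at x0 alone
    would not help to compare two points much closer to each other than to
    x0. *)
Lemma C1_lipschitz_near (R : realType) (m n : nat)
    (f : 'rV[R]_m -> 'rV[R]_n) (x0 : 'rV[R]_m) : Ck_on 1 setT f ->
  exists2 K : R, 0 <= K & \forall z \near (x0, x0),
    `|f z.1 - f z.2| <= K * `|z.1 - z.2|.
Proof.
move=> [fdiff /= dfcont].
pose K := \sum_(i < m) (`|'d f x0 (delta_mx 0 i)| + 1).
exists K; first by apply: sumr_ge0 => i _; rewrite addr_ge0.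
have dfK i : \forall x \near x0,
    `|'d f x (delta_mx 0 i)| <= `|'d f x0 (delta_mx 0 i)| + 1.
  have dfi : 'd f x (delta_mx 0 i) @[x --> x0] --> 'd f x0 (delta_mx 0 i).
    exact: dfcont.
  by apply: (cvgr_norm_le _ dfi); rewrite ltrDl.
have [e /= e0 He] := (nbhs_ballP _ _).1 (filter_forall _ dfK).
exists (ball x0 e, ball x0 e); first by split; exact: nbhsx_ballx.
move=> [x y] /= [xe ye].
pose c (t : R) := t *: (x - y) + y.
have ce t : 0 <= t <= 1 -> ball x0 e (c t).
  move=> /andP[t0 t1]; move: xe ye; rewrite -!ball_normE /= => xe ye.
  have -> : x0 - c t = t *: (x0 - x) + (1 - t) *: (x0 - y).
    apply/rowP => i; rewrite !mxE; ring.
  apply: le_lt_trans (ler_normD _ _) _; rewrite !normrZ.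
  rewrite (ger0_norm t0) ger0_norm ?subr_ge0 //.
  have [xy|/ltW yx] := leP `|x0 - x| `|x0 - y|; nra.
have cder (t : R) : is_derive t 1 c (x - y).
  rewrite (_ : c = (fun s => s *: (x - y)) + cst y) //.
  rewrite -[X in is_derive _ _ _ X]addr0; apply: is_deriveD.
  rewrite -[X in is_derive _ _ _ X]scale1r; apply: (is_derive_scalev (a := id)).
have -> : `|f x - f y| = `|(f \o c) 1 - (f \o c) 0|.
  by rewrite /= /c scale1r scale0r add0r subrK.
rewrite -[leRHS]mulr1 -[X in _ <= _ * X]subr0.
apply: (@mean_value_norm_le _ _ _ (fun t => 'd f (c t) (x - y))) => //.
  move=> t _; have [/derivable1_diffP ct <-] := cder t.
  have [fcdiff fcE] :=
    is_diff_comp (differentiableP ct) (differentiableP (fdiff (c t) I)).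
  apply: DeriveDef; first exact/derivable1_diffP.
  by rewrite !deriveE // fcE.
move=> t t01; apply: le_trans (linear_norm_le _ _) _.
rewrite ler_wpM2r //; apply: ler_sum => i _; exact: He (ce t t01) i.
Qed.

(** Splits dtL L x - dtL L y as 'd L x (L x - L y) + ('d L x - 'd L y) (L y):
    the first term is controlled by the Lipschitz bound on L, the second by the
    Lipschitz bounds on the partial derivatives of L. *)
Lemma dtL_lipschitz_near (R : realType) (m : nat) (L : 'rV[R]_m -> 'rV[R]_m)
    (x0 : 'rV[R]_m) : smooth_on setT L ->
  exists2 K : R, 0 <= K & \forall z \near (x0, x0),
    `|dtL L z.1 - dtL L z.2| <= K * `|z.1 - z.2|.
Proof.
move=> Lsmooth.
have [A A0 LA] := C1_lipschitz_near x0 (Lsmooth 1%N).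
have dLlip (i : 'I_m) : exists K : R, 0 <= K /\ \forall z \near (x0, x0),
    `|'d L (z.1) (delta_mx 0 i) - 'd L (z.2) (delta_mx 0 i)|
      <= K * `|z.1 - z.2|.
  have [K K0 HK] := C1_lipschitz_near x0 ((Lsmooth 2%N).2 (delta_mx 0 i)).
  by exists K.
have [K HK] := choice dLlip.
pose B := \sum_(i < m) (`|'d L x0 (delta_mx 0 i)| + 1).
have B0 : 0 <= B by apply: sumr_ge0 => i _; rewrite addr_ge0.
have K0 : 0 <= \sum_i K i by apply: sumr_ge0 => i _; have [] := HK i.
exists (B * A + (\sum_i K i) * (`|L x0| + 1)).
  by rewrite addr_ge0 // mulr_ge0 // addr_ge0.
have dLB i : \forall z \near (x0, x0),
    `|'d L (z.1) (delta_mx 0 i)| <= `|'d L x0 (delta_mx 0 i)| + 1.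
  have dLi : 'd L (z.1) (delta_mx 0 i) @[z --> (x0, x0)] -->
      'd L x0 (delta_mx 0 i).
    apply: (@cvg_comp _ _ _ fst (fun x => 'd L x (delta_mx 0 i))).
      exact: cvg_fst.
    exact: (Lsmooth 1%N).2.
  by apply: (cvgr_norm_le _ dLi); rewrite ltrDl.
have LB : \forall z \near (x0, x0), `|L z.2| <= `|L x0| + 1.
  have Lx : L z.2 @[z --> (x0, x0)] --> L x0.
    apply: (@cvg_comp _ _ _ snd L); first exact: cvg_snd.
    exact: (Lsmooth 0%N).
  by apply: (cvgr_norm_le _ Lx); rewrite ltrDl.
have dLK i : \forall z \near (x0, x0),
    `|'d L (z.1) (delta_mx 0 i) - 'd L (z.2) (delta_mx 0 i)|
      <= K i * `|z.1 - z.2|.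
  by have [] := HK i.
near=> z.
have split_diff (g h : {linear 'rV[R]_m -> 'rV[R]_m}) (a b : 'rV[R]_m) :
  g a - h b = g (a - b) + (g \- h) b by rewrite linearB /= addrA subrK.
rewrite /dtL split_diff.
rewrite mulrDl; apply: le_trans (ler_normD _ _) _; apply: lerD.
  apply: le_trans (linear_norm_le _ _) _; rewrite -mulrA ler_pM //.
  - by apply: sumr_ge0.
  - by apply: ler_sum => i _; move: i; near: z; exact: filter_forall.
  - by near: z.
apply: le_trans (linear_norm_le _ _) _.
rewrite mulrAC ler_pM //.
- by apply: sumr_ge0.
- rewrite mulr_suml; apply: ler_sum => i _ /=.
  by move: i; near: z; exact: filter_forall.
- by near: z.
Unshelve. all: by end_near. Qed.

(** * Size of the perturbation of the coefficient *)

Lemma derivable_lipschitz_at (R : realType) (f : R -> R) (x : R) :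
  derivable f x 1 ->
  exists2 A : R, 0 <= A & \forall h \near (0 : R),
    `|f (x + h) - f x| <= A * `|h|.
Proof.
move=> fx; exists (`|'D_1 f x| + 1); first by rewrite addr_ge0.
have := cvgr_norm_le _ fx (`|'D_1 f x| + 1).
rewrite ltrDl ltr01 => /(_ _ isT).
rewrite near_withinE.
apply: filterS => h /=; have [->|h0 /(_ isT)] := eqVneq h 0.
  by rewrite addr0 subrr !normr0 mulr0.
rewrite normrZ normfV mulrC ler_pdivrMr ?normr_gt0 //.
by rewrite [h%:A]mulr1 [h + x]addrC.
Qed.

(** For 0 < tau <= 1 and 1 <= p one has tau `^ p <= tau, so the argument C tau^p
    is of first order in tau. *)
Lemma powR_perturbation_le (R : realType) (alpha : R -> R) (C p : R) :
    1 <= p -> derivable alpha 0 1 ->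
  exists2 A : R, 0 <= A & \forall tau \near 0^'+,
    `|alpha (C * tau `^ p) - alpha 0| <= A * tau.
Proof.
move=> p1 /derivable_lipschitz_at[A A0 HA].
exists (A * `|C|); first by rewrite mulr_ge0.
have to0 : C * tau `^ p @[tau --> 0^'+] --> (0 : R).
  rewrite -[X in _ --> X](mulr0 C); apply: cvgM; first exact: cvg_cst.
  by apply: powR_cvg0; exact: lt_le_trans p1.
near=> tau.
have tau0 : 0 < tau by near: tau; exact: nbhs_right_gt.
have tau1 : tau <= 1 by near: tau; exact: nbhs_right_ltW.
have : `|alpha (0 + C * tau `^ p) - alpha 0| <= A * `|C * tau `^ p|.
  by near: tau; exact: to0 _ HA.
rewrite add0r => /le_trans; apply.
rewrite normrM -mulrA; apply: ler_wpM2l => //; apply: ler_wpM2l => //.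
by rewrite ger0_norm ?powR_ge0 // ge1r_powR // tau0.
Unshelve. all: by end_near. Qed.

(** * Derivatives of a solution *)

(** Iterates the directional derivative that occurs in smooth_on, which makes
    smoothness on U pass to every iterate by definition; other total extensions
    of the derivative could differ from it off U. *)
Definition nth_deriv (R : realType) (V : normedModType R) (u : R -> V) (k : nat)
  : R -> V := iter k (fun (f : R -> V) t => 'd f t 1) u.
Arguments nth_deriv : simpl never.

Lemma smooth_nth_deriv (R : realType) (V : normedModType R) (U : set R)
    (u : R -> V) (k : nat) : smooth_on U u -> smooth_on U (nth_deriv u k).
Proof. by move=> usmooth; elim: k => //= k IHk j; exact: (IHk j.+1).2. Qed.

Lemma is_derive_nth_deriv (R : realType) (V : normedModType R) (U : set R)
    (u : R -> V) (k : nat) (t : R) : smooth_on U u -> U t ->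
  is_derive t 1 (nth_deriv u k) (nth_deriv u k.+1 t).
Proof.
move=> usmooth Ut; have [dku _] := smooth_nth_deriv k usmooth 1%N.
apply: DeriveDef; first exact/derivable1_diffP/dku.
by rewrite deriveE //; exact: dku.
Qed.

Lemma nth_deriv1_ode (R : realType) (m : nat) (L : 'rV[R]_m -> 'rV[R]_m)
    (U : set R) (u : R -> 'rV[R]_m) (t : R) : smooth_on U u ->
    (forall t, U t -> is_derive t 1 u (L (u t))) ->
  U t -> nth_deriv u 1 t = L (u t).
Proof.
move=> usmooth odeu Ut; have [_ <-] := odeu t Ut.
by have [_ ->] := is_derive_nth_deriv 0 usmooth Ut.
Qed.

(** Chain rule: the derivative of L o u is L_u(u) u' = L_u(u) L(u).  As the
    equation u' = L(u) holds on U only, differentiating it uses that U is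
    open. *)
Lemma nth_deriv2_ode (R : realType) (m : nat) (L : 'rV[R]_m -> 'rV[R]_m)
    (U : set R) (u : R -> 'rV[R]_m) (t : R) : smooth_on setT L ->
    open U -> smooth_on U u ->
    (forall t, U t -> is_derive t 1 u (L (u t))) ->
  U t -> nth_deriv u 2 t = dtL L (u t).
Proof.
move=> Lsmooth Uopen usmooth odeu Ut.
have u1E : \forall s \near t, nth_deriv u 1 s = L (u s).
  apply: filterS (open_nbhs_nbhs (conj Uopen Ut)) => s.
  exact: (nth_deriv1_ode usmooth odeu).
have [_ <-] := is_derive_nth_deriv 1 usmooth Ut.
rewrite (near_eq_derive (1 : R) u1E).
have udiff := (usmooth 1%N).1 t Ut.
have Ldiff := (Lsmooth 1%N).1 (u t) I.
have [Lu LuE] := is_diff_comp (differentiableP udiff) (differentiableP Ldiff).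
rewrite deriveE // LuE /= -[in RHS]/(_ (L (u t))) /dtL.
by rewrite -(nth_deriv1_ode usmooth odeu Ut).
Qed.

(** * Defects of the two stages *)

(** The stage compared with a reference state v, in practice u(tn + s).  The
    first term measures the failure of tau^2 / (12 (1 - a)) to be s^2 / 2; it
    vanishes for a = 1/3, when s = tau / 2.  The second is a Taylor remainder of
    order 3. *)
Lemma ustar_defectE (R : realType) (m : nat) (L : 'rV[R]_m -> 'rV[R]_m)
    (a tau s : R) (un v : 'rV[R]_m) : 1 - a != 0 -> s = tau / (3 * (1 - a)) ->
  ustar L a tau un - v =
    (tau ^+ 2 * (1 - 3 * a) / (36 * (1 - a) ^+ 2)) *: dtL L un
    - (v - (un + s *: L un + (s ^+ 2 / 2) *: dtL L un)).
Proof.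
move=> a1 ->; rewrite /ustar; move: (L un) (dtL L un) => x y.
apply/rowP => i; rewrite !mxE; field.
by rewrite a1.
Qed.

(** Here x stands for u(tn + tau), y for the second derivative of u at tn + s,
    and u3, u4 for its third and fourth derivatives at tn.  The three groups of
    terms are a Taylor remainder of order 5, the errors made in replacing
    G(ustar) by the Taylor polynomial of the second derivative, and the mismatch
    of the u4 coefficients, 1/24 against 1/(36 (1 - a)). *)
Lemma unext_defectE (R : realType) (m : nat) (L : 'rV[R]_m -> 'rV[R]_m)
    (a tau s : R) (un x y u3 u4 : 'rV[R]_m) : 1 - a != 0 ->
    s = tau / (3 * (1 - a)) ->
  x - unext L a tau un =
    (x - (un + tau *: L un + (tau ^+ 2 / 2) *: dtL L un
            + (tau ^+ 3 / 6) *: u3 + (tau ^+ 4 / 24) *: u4))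
    - ((1 - a) * tau ^+ 2 / 2) *:
        ((dtL L (ustar L a tau un) - y)
         + (y - (dtL L un + s *: u3 + (s ^+ 2 / 2) *: u4)))
    + (tau ^+ 4 * (1 - 3 * a) / (72 * (1 - a))) *: u4.
Proof.
move=> a1 ->; rewrite /unext.
move: (dtL L (ustar _ _ _ _)) (L un) (dtL L un) => z v w.
apply/rowP => i; rewrite !mxE; field.
by rewrite a1.
Qed.

(** Both coefficient mismatches contain the factor 1 - 3 a = - 3 (a - 1/3),
    which supplies the extra power of tau; the bound 3 <= d absorbs the
    constant. *)
Lemma coef_defect_le (R : realType) (a A tau d : R) (k : nat) :
    0 <= tau -> `|a - 3^-1| <= A * tau -> 3 <= d ->
  `|tau ^+ k * (1 - 3 * a) / d| <= A * tau ^+ k.+1.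
Proof.
move=> tau0 aA d3; have d0 : 0 < d by apply: lt_le_trans d3.
have tauk := exprn_ge0 k tau0.
have Atau : 0 <= A * tau by apply: le_trans aA.
rewrite !normrM normfV (gtr0_norm d0) (ger0_norm tauk).
have -> : 1 - 3 * a = - (3 * (a - 3^-1)) by field.
rewrite normrN normrM (@ger0_norm _ 3) // ler_pdivrMr //.
rewrite exprS; set x := `|_|.
rewrite [leLHS](_ : _ = 3 * (tau ^+ k * x)); last by ring.
rewrite [leRHS](_ : _ = d * (tau ^+ k * (A * tau))); last by ring.
apply: ler_pM => //; first by rewrite mulr_ge0 // normr_ge0.
by rewrite ler_wpM2l.
Qed.

(** * Fourth-order accuracy *)

Theorem mainTheorem1 (R : realType) (m : nat)
    (L : 'rV[R]_m -> 'rV[R]_m) (smoothL : smooth_on setT L)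
    (tn : R) (U : set R) (Utn : open_nbhs tn U)
    (u : R -> 'rV[R]_m) (smoothu : smooth_on U u)
    (odeu : forall t, U t -> is_derive t 1 u (L (u t)))
    (p C : R) (p_ge1 : 1 <= p)
    (alpha : R -> R)
    (dalpha : \forall x \near (0 : R), derivable alpha x 1)
    (alpha0 : alpha 0 = 3^-1)
    (alpha_neq1 : \forall x \near (0 : R), alpha x != 1) :
  (fun tau : R => u (tn + tau) - unext L (alpha (C * tau `^ p)) tau (u tn))
    =O_ (0^'+) (fun tau : R => tau ^+ 5).
Proof.
have [Uopen Utn0] := Utn.
have nearU : \forall t \near tn, U t by exact: open_nbhs_nbhs.
have u1E : nth_deriv u 1 tn = L (u tn) := nth_deriv1_ode smoothu odeu Utn0.
have u2E t : U t -> nth_deriv u 2 t = dtL L (u t).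
  exact: (nth_deriv2_ode smoothL Uopen smoothu odeu).
set u3 := nth_deriv u 3 tn; set u4 := nth_deriv u 4 tn.
set un := u tn.
have taylor j n : exists2 M : R, 0 <= M & \forall t \near tn, tn <= t ->
    `|nth_deriv u j t - \sum_(k < n) ((t - tn) ^+ k / k`!%:R) *:
      nth_deriv u (k + j) tn| <= M * (t - tn) ^+ n.
  apply: (@taylor_remainder_le R m n (fun k => nth_deriv u (k + j)) tn).
    apply: filterS nearU => t Ut k _; exact: is_derive_nth_deriv.
  exact: (smooth_nth_deriv _ smoothu 0%N).
have [M5 M5_ge0 T5] := taylor 0%N 5%N.
have [M3 M3_ge0 T3] := taylor 0%N 3%N.
have [N3 N3_ge0 S3] := taylor 2%N 3%N.
have [K K_ge0 /nbhs_ballP[r /= r0 lipG]] := dtL_lipschitz_near un smoothL.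
have u_near : \forall t \near tn, ball un r (u t).
  have cu : u t @[t --> tn] --> un := smoothu 0%N tn Utn0.
  exact: (cu _ (nbhsx_ballx _ _ r0)).
have [e /= e0 He] := (nbhs_ballP _ _).1
  (filterI (filterI T5 T3) (filterI S3 (filterI nearU u_near))).
have [A A_ge0 alphaA] :=
  powR_perturbation_le C p_ge1 (nbhs_singleton dalpha).
rewrite alpha0 in alphaA.
(* One summand per source of error: the remainder of u(tn + tau), the
   difference of G between ustar and u(tn + s), the remainder of the second
   derivative at tn + s, and the mismatch of the u4 coefficients. *)
pose B := M5 + K * (A * `|dtL L un| + M3) + N3 + A * `|u4|.
have B_ge0 : 0 <= B by rewrite !addr_ge0 ?mulr_ge0 ?addr_ge0 ?mulr_ge0.
apply/eqO_exP; exists (B + 1); first by rewrite ltr_wpDl.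
near=> tau.
have tau_gt0 : 0 < tau by near: tau; exact: nbhs_right_gt.
have tau_le1 : tau <= 1 by near: tau; exact: nbhs_right_ltW.
have tau_lte : tau < e by near: tau; exact: nbhs_right_lt.
have alpha_tau : `|alpha (C * tau `^ p) - 3^-1| <= A * tau by near: tau.
have Atau : tau < (6 * (A + 1))^-1.
  by near: tau; apply: nbhs_right_lt; rewrite invr_gt0 mulr_gt0 // ltr_wpDl.
have rtau : tau < r / (`|L un| + `|dtL L un| + 1).
  by near: tau; apply: nbhs_right_lt; rewrite divr_gt0 // ltr_wpDl ?addr_ge0.
move: alpha_tau; set a := alpha _ => alpha_tau.
(* Keeps 1 - a between 1/2 and 5/6: it is not 0, and 0 < s <= tau. *)
have Atau6 : A * tau <= 6^-1.
  move: Atau; rewrite invfM => Atau.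
  have : tau * (A + 1) <= 6^-1.
    by rewrite -ler_pdivlMr ?ltr_wpDl // ltW.
  nra.
have a_itv : `|a - 3^-1| <= 6^-1 by exact: le_trans Atau6.
have [a_lo a_hi] : 6^-1 <= a /\ a <= 2^-1.
  by move: a_itv; rewrite ler_norml => /andP[]; split; lra.
have q0 : 1 - a != 0 by apply/eqP; lra.
pose s := tau / (3 * (1 - a)).
have s0 : 0 < s by rewrite divr_gt0 //; lra.
have s_tau : s <= tau by rewrite ler_pdivrMr; nra.
(* Makes all the Taylor bounds available at tn + tau and tn + s. *)
have in_ball h : 0 <= h <= tau -> ball tn e (tn + h).
  move=> /andP[h0 htau]; rewrite /ball/= opprD addNKr normrN ger0_norm //.
  exact: le_lt_trans tau_lte.
have [[T5tau _] _] := He _ (in_ball tau ltac:(by rewrite lexx ltW)).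
have [[_ T3s] [S3s [Us us_ball]]] :=
  He _ (in_ball s ltac:(by rewrite s_tau ltW)).
have leD h : 0 < h -> tn <= tn + h by move=> h0; rewrite lerDl ltW.
have addK h : tn + h - tn = h by rewrite addrAC subrr add0r.
move: T5tau => /(_ (leD _ tau_gt0)); rewrite addK.
move: T3s S3s => /(_ (leD _ s0)) T3s /(_ (leD _ s0)).
move: T3s; rewrite addK !big_ord_recr !big_ord0 /= !addn0 !add0n.
rewrite !add0r !expr0 !expr1 !divr1 !scale1r.
rewrite -[2`!]/2%N -[3`!]/6%N -[4`!]/24%N -[(1 + 2)%N]/3%N -[(2 + 2)%N]/4%N.
rewrite u1E !u2E // -/un -/u3 -/u4 -[nth_deriv u 0]/u -/un => T3s S3s T5tau.
have tau0 := ltW tau_gt0.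
have s3 : s ^+ 3 <= tau ^+ 3 by rewrite lerXn2r // nnegrE // ltW.
have defect k d : 3 <= d ->
    `|tau ^+ k * (1 - 3 * a) / d| <= A * tau ^+ k.+1.
  exact: coef_defect_le.
have stage : `|ustar L a tau un - u (tn + s)|
    <= (A * `|dtL L un| + M3) * tau ^+ 3.
  rewrite (@ustar_defectE _ _ _ _ _ s) //.
  apply: le_trans (ler_normB _ _) _; rewrite [leRHS]mulrDl; apply: lerD.
    by rewrite normrZ [leRHS]mulrAC ler_wpM2r // defect //; nra.
  by apply: le_trans T3s _; rewrite ler_wpM2l.
have ustar_ball : ball un r (ustar L a tau un).
  rewrite -ball_normE /= distrC addrC /ustar !addrA addNr add0r.
  apply: (@le_lt_trans _ _ (tau * (`|L un| + `|dtL L un| + 1))); last first.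
    by rewrite -ltr_pdivlMr // ltr_wpDl ?addr_ge0.
  apply: le_trans (ler_normD _ _) _; rewrite -[in leRHS]addrA [leRHS]mulrDr.
  apply: lerD; rewrite normrZ.
    by rewrite ler_wpM2r // -/s ger0_norm // ltW.
  rewrite ger0_norm; last by rewrite divr_ge0 ?exprn_ge0 //; nra.
  apply: ler_pM => //; first by rewrite divr_ge0 ?exprn_ge0 //; nra.
    by rewrite ler_pdivrMr; nra.
  by rewrite lerDl.
have dtL_stage := lipG (ustar L a tau un, u (tn + s)) (conj ustar_ball us_ball).
rewrite (@unext_defectE _ _ _ _ _ s _ _ (dtL L (u (tn + s))) u3 u4) //.
rewrite (ger0_norm (exprn_ge0 5 tau0)).
have tau5 := exprn_ge0 5 tau0; have tau3 := exprn_ge0 3 tau0.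
apply: (@le_trans _ _ (B * tau ^+ 5)); last by rewrite ler_wpM2r // lerDl.
rewrite /B [leRHS]mulrDl -(addrA M5).
apply: le_trans (ler_normD _ _) _; apply: lerD; last first.
  by rewrite normrZ [leRHS]mulrAC ler_wpM2r // defect //; nra.
rewrite [leRHS]mulrDl; apply: le_trans (ler_normB _ _) _; apply: lerD => //.
rewrite normrZ.
have half : `|(1 - a) * tau ^+ 2 / 2| <= tau ^+ 2.
  by rewrite ger0_norm; nra.
have -> : (K * (A * `|dtL L un| + M3) + N3) * tau ^+ 5 =
    tau ^+ 2 *
      (K * ((A * `|dtL L un| + M3) * tau ^+ 3) + N3 * tau ^+ 3) by ring.
apply: ler_pM => //; apply: le_trans (ler_normD _ _) _; apply: lerD.
  by apply: le_trans dtL_stage _; rewrite ler_wpM2l.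
by apply: le_trans S3s _; rewrite ler_wpM2l.
Unshelve. all: by end_near. Qed.
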